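(* Let $(\Omega,d,\mu)$ be a doubling metric measure space with upper dimension $Q$ which satisfies the non-collapsing condition $\inf_{x\in\Omega}\mu(B(x,1))=b>0$. Let $X=L^{p,r}(\log L)^\beta$ be a Lorentz–Zygmund space on $\Omega$ ($0<p<\infty$, $0<r\le\infty$, $\beta\in\mathbb R$). Let $0<s<1$, $0<q\le\infty$. The embedding $$\|f\|_{L^\infty}\preceq\|f\|_{\dot B^s_{L^{p,r}(\log L)^\beta,q}}+\|f\|_{L^{\min(1,p,r)}+L^\infty}$$ holds in the following situations: (1) $s>\frac Qp$. (2) $s=\frac Qp$ and $$\begin{cases}\beta>\frac1{\min(1,p,r)}-\frac1q&\text{if }\min(1,p,r)<q\le\infty,\\ \beta\ge0&\text{if }0<q\le\min(1,p,r).\end{cases}$$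
   Context: $A\preceq B$ means $A\le cB$ with $c>0$ independent of $f$; $1/\infty=0$. Doubling metric measure space: $(\Omega,d)$ is a metric space, $B(x,\rho)=\{y\in\Omega: d(x,y)<\rho\}$, and $\mu$ is a Borel measure with $0<\mu(B)<\infty$ for every ball $B$, such that for some $C>1$ one has $\mu(B(x,2\rho))\le C\mu(B(x,\rho))$ for all $x\in\Omega$, $\rho>0$; the smallest such $C$ is $C_\mu$, and $Q=\log_2C_\mu$ is the upper dimension. Standing assumptions: $\mu(\Omega)=\infty$ and $\mu(\{x\})=0$ for all $x\in\Omega$. For measurable $f$, $f^*(t)=\inf\{\sigma\ge0:\mu\{|f|>\sigma\}\le t\}$. The Lorentz–Zygmund space $L^{p,r}(\log L)^\beta$ consists of the measurable $f$ with finite quasi-norm $\left(\int_0^\infty\left[t^{1/p}\left(1+\ln^+\frac1t\right)^\beta f^*(t)\right]^r\frac{dt}t\right)^{1/r}$ if $r<\infty$, or $\sup_{t>0}t^{1/p}\left(1+\ln^+\frac1t\right)^\beta f^*(t)$ if $r=\infty$. For $0<\gamma\le 1$, $\|f\|_{L^\gamma+L^\infty}=\inf\{\|f_0\|_{L^\gamma}+\|f_1\|_{L^\infty}:f=f_0+f_1\}$. Besov seminorm: for $X=L^{p,r}(\log L)^\beta$ it is formed with a fixed exponent $0<\alpha\le1$ satisfying: $\alpha<p$ if ($0<p<r$ with $0<p\le1$) or ($0<p=r\le1$ and $\beta<0$); $\alpha=\min(1,r)$ otherwise. For such $\alpha$ the space $X^{(1/\alpha)}=\{f:|f|^{1/\alpha}\in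 X\}$, $\|f\|_{X^{(1/\alpha)}}=\||f|^{1/\alpha}\|_X^{\alpha}$, is (up to equivalence of norms) a Banach rearrangement invariant space. With $$\nabla_\rho^\alpha f(x)=\left(\frac1{\mu(B(x,\rho))}\int_{B(x,\rho)}|f(x)-f(y)|^\alpha d\mu(y)\right)^{1/\alpha},\qquad E_X(f,\rho)=\|\nabla^\alpha_\rho f\|_X,$$ $\|f\|_{\dot B^s_{X,q}}=\left(\int_0^\infty(\rho^{-s}E_X(f,\rho))^q\frac{d\rho}\rho\right)^{1/q}$ (supremum over $\rho>0$ if $q=\infty$). *)

(* Defs.v *)
From HB Require Import structures.
From mathcomp Require Import all_boot all_order all_algebra.
From mathcomp Require Import all_classical all_reals all_analysis.
Set Implicit Arguments.
Unset Strict Implicit.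
Unset Printing Implicit Defensive.
Import Order.TTheory GRing.Theory Num.Theory.
Import numFieldNormedType.Exports.
Local Open Scope classical_set_scope.
Local Open Scope ring_scope.
Local Open Scope ereal_scope.

(* A metric space with its Borel sigma-algebra.  The point inherited from
   measurableType is harmless: the measures considered below have infinite
   total mass, so the space is nonempty. *)
HB.mixin Record Measurable_isBorelMetric (d : measure_display) (R : realType) T
    of Measurable d T & Metric R T := {
  borel_measurableE : (measurable : set (set T)) = <<s [set A : set T | open A] >>
}.

#[short(type="borelMetricType")]
HB.structure Definition BorelMetric (d : measure_display) (R : realType) :=
  {T of Measurable d T & Metric R T & Measurable_isBorelMetric d R T}.

Section Doubling.
Context (d : measure_display) (R : realType) (T : borelMetricType d R).
Variable mu : {measure set T -> \bar R}.

(* On a metricType, ball x rho = [set y | mdist x y < rho] by ballEmdist. *)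
Definition doubling_constant (C : R) : Prop :=
  (1 < C)%R /\
  forall (x : T) (rho : R), (0 < rho)%R ->
    mu (ball x (2 * rho)%R) <= C%:E * mu (ball x rho).

Definition doubling_measure : Prop :=
  (forall (x : T) (rho : R), (0 < rho)%R -> 0 < mu (ball x rho) < +oo) /\
  exists C : R, doubling_constant C.

(* When mu is doubling and mu setT = +oo, the infimum is attained: doubling
   inequalities pass to the limit in C, and C = 1 would bound mu setT by the
   measure of a single ball. *)
Definition smallest_doubling_constant : R := inf doubling_constant.

Definition upper_dimension : R := (ln smallest_doubling_constant / ln 2)%R.

End Doubling.

Section LorentzZygmund.
Context (d : measure_display) (R : realType) (T : measurableType d).
Variable mu : {measure set T -> \bar R}.

(* Functions are extended-valued here because they will be instantiated with
   averages that may be infinite; the infimum of the empty set is +oo. *)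
Definition rearrangement (g : T -> \bar R) (t : R) : \bar R :=
  ereal_inf [set sigma%:E | sigma in
    [set sigma : R | (0 <= sigma)%R /\
                     mu [set x | sigma%:E < `|g x|] <= t%:E]].

Definition lnp (t : R) : R := Num.max 0%R (ln t).

Definition LZ_weight (p beta t : R) : R :=
  (t `^ p^-1 * (1 + lnp t^-1) `^ beta)%R.

Definition LZ_norm (p : R) (r : \bar R) (beta : R) (g : T -> \bar R) : \bar R :=
  match r with
  | r'%:E =>
      (\int[lebesgue_measure]_(t in `]0%R, +oo[)
         (((LZ_weight p beta t)%:E * rearrangement g t) `^ r' * (t^-1)%:E))
        `^ r'^-1
  | +oo => ereal_sup [set (LZ_weight p beta t)%:E * rearrangement g t
                     | t in [set t : R | (0 < t)%R]]
  | -oo => 0 (* junk value *)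
  end.

Definition sum_norm (gamma : \bar R) (f : T -> R) : \bar R :=
  ereal_inf [set y | exists f0 f1 : T -> R,
    [/\ measurable_fun setT f0, measurable_fun setT f1,
        (forall x, f x = f0 x + f1 x)%R &
        y = 'N[mu]_gamma [EFin \o f0] + 'N[mu]_+oo [EFin \o f1]]].

End LorentzZygmund.

Definition admissible_exponent (R : realType) (p : R) (r : \bar R)
    (beta alpha : R) : Prop :=
  let exceptional :=
    (p%:E < r /\ (p <= 1)%R) \/ [/\ p%:E = r, (p <= 1)%R & (beta < 0)%R] in
  [/\ (0 < alpha <= 1)%R,
      exceptional -> (alpha < p)%R &
      ~ exceptional -> alpha%:E = Order.min 1 r].

Section Besov.
Context (d : measure_display) (R : realType) (T : borelMetricType d R).
Variable mu : {measure set T -> \bar R}.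

Definition nabla (alpha rho : R) (f : T -> R) (x : T) : \bar R :=
  ((mu (ball x rho))^-1 *
   \int[mu]_(y in ball x rho) (`|f x - f y| `^ alpha)%:E) `^ alpha^-1.

Definition LZ_modulus (alpha p : R) (r : \bar R) (beta : R) (f : T -> R)
    (rho : R) : \bar R :=
  LZ_norm mu p r beta (nabla alpha rho f).

Definition besov_seminorm (alpha s p : R) (r : \bar R) (beta : R) (q : \bar R)
    (f : T -> R) : \bar R :=
  match q with
  | q'%:E =>
      (\int[lebesgue_measure]_(rho in `]0%R, +oo[)
         (((rho `^ (- s))%:E * LZ_modulus alpha p r beta f rho) `^ q'
            * (rho^-1)%:E))
        `^ q'^-1
  | +oo => ereal_sup [set (rho `^ (- s))%:E * LZ_modulus alpha p r beta f rho
                     | rho in [set rho : R | (0 < rho)%R]]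
  | -oo => 0 (* junk value *)
  end.

End Besov.

(* Main.v *)
Require Import Defs.
From HB Require Import structures.
From mathcomp Require Import all_boot all_order all_algebra.
From mathcomp Require Import finmap.
From mathcomp Require Import all_classical all_reals all_analysis.
From mathcomp Require Import ess_sup_inf measurable_realfun.
From mathcomp Require Import lra ring.
Set Implicit Arguments.
Unset Strict Implicit.
Unset Printing Implicit Defensive.
Import Order.TTheory GRing.Theory Num.Theory.
Import numFieldNormedType.Exports.
Local Open Scope classical_set_scope.
Local Open Scope ring_scope.
Local Open Scope ereal_scope.

(** The proof compares superlevel sets of [f] at geometrically decreasing
    measures, and never averages [f] itself.

    Fix a radius [rho] such that every ball [B(x, rho)] has measure at least
    [2 tau], and a level [lam] with [mu {|f| > lam} <= tau].  If
    [|f x| > lam + del], then at least half of [B(x, rho)] consists of points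
    [y] with [|f y| <= lam], where [|f x - f y| >= del]; hence
    [nabla f x >= 2^(-1/alpha) del] ([nabla_ge]).  So if [{|f| > lam + del}]
    had measure larger than [t], the rearrangement of [nabla f] would be at
    least [2^(-1/alpha) del] up to [t], and testing the Lorentz-Zygmund norm on
    [[t/2, t]] would give [E_X(f, rho) >= c t^(1/p) (1 + ln^+ (1/t))^beta del]
    ([LZ_modulus_ge]).  Read backwards: going from measure [tau] to measure [t]
    raises the level by at most [E_X(f, rho) / (c W(t))], where [W] is the
    Lorentz-Zygmund weight.

    Doubling and non-collapsing give [mu B(x, rho) >= b 2^(-kD)] for
    [rho >= 2^(-k)], for every [D >= Q] ([mu_ball_rad_ge]).  The step above
    thus leads from [t_k = t_0 2^(-kD)] to [t_(k+1)] with any [rho] in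
    [[2^(-k-1), 2^(-k)[], hence with the infimum [v_k] of [E_X(f, .)] over that
    interval.  If the Besov seminorm is at most [M], the numbers
    [2^(ks) v_k / M] are bounded in l^q ([scale_norm_infima]).  Summing the
    steps, the level at measure [t_N] exceeds the level at [t_0] by at most a
    multiple of [M] times the sum of these numbers against the weights
    [2^(-(k+1)(s - D/p)) (k+1)^(-beta)].  This sum is bounded independently of
    [N] ([log_weight_dual]): for [s > Q/p] choose [D < sp] and the weights decay
    geometrically; for [s = Q/p] take [D = Q] and use that the weights are
    bounded when [q <= 1], and in l^(q') when [q > 1].  The level at
    [t_0] is controlled by the norm in [L^gamma + L^oo] through Markov's
    inequality ([superlevel_sum_norm]).  Letting [N] tend to infinity, the set
    where [|f|] exceeds the total is null.

    The rearrangement only makes sense for measurable functions, so [nabla f]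
    has to be shown measurable.  This is Tonelli's theorem, once the relation
    [d(x, y) < rho] is known to be measurable in the product; for that the
    space must be separable, which holds because a sigma-finite measure charges
    at most countably many disjoint balls. *)

(** * Separability *)

Section Separability.
Context (d : measure_display) (R : realType) (T : borelMetricType d R).
Variable mu : {measure set T -> \bar R}.

Lemma ball_triangle_le (x y z : T) (e1 e2 e3 : R) :
  (e1 + e2 <= e3)%R -> ball x e1 y -> ball y e2 z -> ball x e3 z.
Proof.
rewrite !ballEmdist /= => e h1 h2; apply: le_lt_trans (metric_triangle x y z) _.
by apply: lt_le_trans e; exact: ltrD.
Qed.

Lemma open_ball (x : T) (e : R) : open (ball x e).
Proof.
rewrite openE => y xy; apply/nbhs_ballP; exists (e - mdist x y)%R => /=.
  by move: xy; rewrite ballEmdist /= subr_gt0.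
move=> z; move: xy; rewrite !ballEmdist /= => xy yz.
by apply: le_lt_trans (metric_triangle x y z) _; rewrite -ltrBrDl.
Qed.

Lemma measurable_metric_ball (x : T) (e : R) : measurable (ball x e).
Proof.
by rewrite borel_measurableE; apply: sub_gen_smallest; exact: open_ball.
Qed.

Hypothesis ball_fin : forall (x : T) (e : R), (0 < e)%R ->
  0 < mu (ball x e) < +oo.

(** The measures of disjoint balls inside a fixed ball add up to at most its
    measure, so only finitely many of them exceed a given threshold. *)
Lemma finite_disjoint_balls (E : set T) (e : R) (x0 : T) (n : nat) :
  trivIset E (fun x => ball x e) ->
  (forall x, E x -> ball x e `<=` ball x0 n.+1%:R) ->
  (forall x, E x -> (n.+1%:R^-1)%:E <= mu (ball x e)) -> finite_set E.
Proof.
move=> tE sE mE; apply: contrapT => infE.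
have /andP[_ Bfin] : 0 < mu (ball x0 n.+1%:R) < +oo.
  by apply: ball_fin; rewrite ltr0n.
have Bnum : mu (ball x0 n.+1%:R) \is a fin_num by rewrite ge0_fin_numE.
set b := fine (mu (ball x0 n.+1%:R)).
have [B BE cB] := infinite_set_fset (Num.bound (b * n.+1%:R)) infE.
have : mu (\big[setU/set0]_(x <- B) ball x e) <= b%:E.
  rewrite /b fineK//; apply: le_measure.
  - rewrite inE; apply: bigsetU_measurable => i _.
    exact: measurable_metric_ball.
  - by rewrite inE; exact: measurable_metric_ball.
  - by rewrite -bigcup_fset; apply: bigcup_sub => i /BE /sE.
rewrite measure_fbigsetU; last 2 first.
  by move=> i _; exact: measurable_metric_ball.
  exact: sub_trivIset tE.
apply/negP; rewrite -ltNge.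
apply: (@lt_le_trans _ _ (\sum_(x <- B) (n.+1%:R^-1)%:E)).
  rewrite sumEFin lte_fin big_const_seq count_predT iter_addr_0.
  rewrite -[ltRHS]mulr_natr.
  rewrite ltr_pdivlMl ?ltr0n// mulrC.
  apply: lt_le_trans (archi_boundP _) _.
    by rewrite mulr_ge0// fine_ge0.
  by rewrite ler_nat.
by rewrite big_seq [leRHS]big_seq; apply: lee_sum => i iB; apply/mE/BE.
Qed.

Lemma countable_disjoint_balls (E : set T) (e : R) : (0 < e)%R ->
  trivIset E (fun x => ball x e) -> countable E.
Proof.
move=> e0 tE; pose x0 : T := point.
pose En (n : nat) := [set x | [/\ E x, ball x e `<=` ball x0 n.+1%:R &
  (n.+1%:R^-1)%:E <= mu (ball x e)]].
have -> : E = \bigcup_n En n.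
  apply/seteqP; split => [x Ex|x [n _ []]//].
  have /andP[m0 moo] := ball_fin x e0.
  have mfin : mu (ball x e) \is a fin_num by rewrite ge0_fin_numE.
  set m := fine (mu (ball x e)).
  have {}m0 : (0 < m)%R by rewrite fine_gt0// m0.
  pose v : R := Num.max (mdist x0 x + e)%R m^-1%R.
  have vb : (v < (Num.bound v).+1%:R)%R.
    apply: lt_le_trans (archi_boundP _) _; last by rewrite ler_nat.
    by rewrite le_max invr_ge0 (ltW m0) orbT.
  exists (Num.bound v) => //=; split => //.
  - move=> y xy; rewrite ballEmdist /=.
    apply: le_lt_trans (metric_triangle x0 x y) _.
    apply: le_lt_trans vb; rewrite le_max lerD2l.
    by move: xy; rewrite ballEmdist /= => /ltW ->.
  - rewrite -(fineK mfin) lee_fin invf_ple ?posrE ?ltr0n//.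
    by apply: le_trans (ltW vb); rewrite le_max lexx orbT.
apply: bigcup_countable => // n _; apply: finite_set_countable.
apply: (@finite_disjoint_balls _ e x0 n).
- by apply: sub_trivIset tE => x [].
- by move=> x [].
- by move=> x [].
Qed.

(** The centres of a maximal family of disjoint balls of radius [e / 2] form an
    [e]-net: a point at distance [>= e] from all of them could be added. *)
Lemma ex_countable_net (e : R) : (0 < e)%R ->
  exists z : nat -> T, forall x, exists n, ball (z n) e x.
Proof.
move=> e0; have e20 : (0 < e / 2)%R by rewrite divr_gt0.
have [E [_ tE maxE]] :=
  ex_maximal_disjoint_subcollection (fun x : T => ball x (e / 2)) setT.
have netE x : exists2 y, E y & ball y e x.
  apply: contrapT => noy.
  have nEx : ~ E x by move=> Ex; apply: noy; exists x => //; exact: ballxx.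
  apply: (maxE (x |` E)) => //.
    split; first by move=> y; right.
    by move=> /(_ x (or_introl erefl)).
  have key y : E y -> ball x (e / 2) `&` ball y (e / 2) !=set0 -> False.
    move=> Ey [w [xw yw]]; apply: noy; exists y => //.
    by apply: (ball_triangle_le _ yw (ball_sym xw)); rewrite -splitr.
  move=> i j [->|Ei] [->|Ej] //.
  - by move=> /(key _ Ej).
  - by rewrite setIC => /(key _ Ei).
  - exact: tE.
have [E0|/set0P[y0 Ey0]] := eqVneq E set0.
  by have [y] := netE point; rewrite E0.
have /countable_injP[h hinj] : countable E.
  exact: countable_disjoint_balls tE.
exists (fun n => xget y0 [set y | E y /\ h y = n]) => x.
have [y Ey yx] := netE x; exists (h y).
case: xgetP => [w _ [Ew hw]|/(_ y)]; last by case.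
by rewrite (hinj w y) ?inE.
Qed.

Lemma ex_dense_sequence :
  exists z : nat -> T, forall x (e : R), (0 < e)%R -> exists n, ball (z n) e x.
Proof.
have h (m : nat) : exists z : nat -> T,
    forall x, exists n, ball (z n) (m.+1%:R^-1 : R) x.
  by apply: ex_countable_net; rewrite invr_gt0.
have [zz zzP] := choice h.
exists (fun n : nat => let ij := odflt (0%N, 0%N) (choice.unpickle n) in
  zz ij.1 ij.2).
move=> x e e0; have [j zx] := zzP (Num.bound e^-1) x.
exists (choice.pickle (Num.bound e^-1, j)); rewrite choice.pickleK /=.
apply: le_ball zx; rewrite invf_ple ?posrE ?ltr0n//.
apply: (le_trans (ltW (archi_boundP _))); first by rewrite invr_ge0 ltW.
by rewrite ler_nat.
Qed.

End Separability.

(** * Measurability of the averaged differences *)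

Section NablaMeasurable.
Context (d : measure_display) (R : realType) (T : borelMetricType d R).
Variable mu : {measure set T -> \bar R}.
Hypothesis ball_fin : forall (x : T) (e : R), (0 < e)%R ->
  0 < mu (ball x e) < +oo.

(** If [d(x, y) < e], some point [z n] of a dense sequence lies so close to [x]
    that [d(x, z n) < 1 / m] and [d(z n, y) < e - 1 / m] for some [m].  So the
    relation is a countable union of rectangles. *)
Lemma measurable_ball_rel (e : R) :
  measurable [set xy : T * T | ball xy.1 e xy.2].
Proof.
have [z zP] := ex_dense_sequence ball_fin.
have -> : [set xy : T * T | ball xy.1 e xy.2] =
    \bigcup_n \bigcup_m (ball (z n) (m.+1%:R^-1 : R) `*`
                         ball (z n) (e - m.+1%:R^-1)%R).
  apply/seteqP; split => [[x y]|[x y] [n _ [m _ [/= zx zy]]]] /=; last first.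
    by apply: (ball_triangle_le _ (ball_sym zx) zy); rewrite addrC subrK.
  rewrite ballEmdist /= -subr_gt0 => xy.
  pose m := Num.bound (2 / (e - mdist x y)).
  have mP : (2 * m.+1%:R^-1 < e - mdist x y)%R.
    rewrite ltr_pdivrMr ?ltr0n// mulrC -ltr_pdivrMr//.
    apply: (lt_trans (archi_boundP _)); last by rewrite ltr_nat.
    by rewrite divr_ge0// ltW.
  have [|n zx] := zP x (m.+1%:R^-1)%R; first by rewrite invr_gt0.
  exists n => //; exists m => //; split => //=.
  move: zx; rewrite !ballEmdist /= => zx.
  apply: le_lt_trans (metric_triangle _ x _) _.
  move: mP zx; set i := (_.+1%:R^-1)%R; set a := mdist _ _.
  by set c := mdist _ x; lra.
apply: bigcup_measurable => n _; apply: bigcup_measurable => m _.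
by apply: measurableX; exact: measurable_metric_ball.
Qed.

Lemma ball_sigma_finite : sigma_finite [set: T] mu.
Proof.
exists (fun n => ball (point : T) n.+1%:R).
  apply/esym/seteqP; split => // x _.
  exists (Num.bound (mdist point x)) => //; rewrite ballEmdist /=.
  apply: lt_trans (archi_boundP _) _; last by rewrite ltr_nat.
  exact: mdist_ge0.
move=> n; split; first exact: measurable_metric_ball.
by have /andP[] := @ball_fin point n.+1%:R (ltr0Sn _ _).
Qed.

Lemma measurable_ball_integral (e : R) (h : T * T -> \bar R) :
  (forall xy, 0 <= h xy) -> measurable_fun setT h ->
  measurable_fun setT (fun x => \int[mu]_(y in ball x e) h (x, y)).
Proof.
move=> h0 mh.
have sfin : sfinite_measure mu.
  exact/sfinite_measure_sigma_finite/ball_sigma_finite.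
pose m : {sigma_finite_measure set T -> \bar R} :=
  HB.pack (Measure.sort mu) (isSFinite.Build d T R (Measure.sort mu) sfin)
    (isSigmaFinite.Build d T R (Measure.sort mu) ball_sigma_finite).
have -> : (fun x => \int[mu]_(y in ball x e) h (x, y)) =
    fubini_F m (h \_ [set xy : T * T | ball xy.1 e xy.2]).
  apply/funext => x; rewrite /fubini_F [LHS]integral_mkcond.
  refine (f_equal (integral mu setT) _).
  apply/funext => y; rewrite /patch.
  by congr (if _ then _ else _); apply/idP/idP; rewrite !inE.
apply: measurable_fun_fubini_tonelli_F.
  by apply/(measurable_restrictT _ _).1;
    [exact: measurable_ball_rel|exact: measurable_funTS].
by move=> xy; apply: erestrict_ge0.
Qed.

Lemma measurable_mu_ball (e : R) : measurable_fun setT (fun x => mu (ball x e)).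
Proof.
have -> : (fun x => mu (ball x e)) =
    (fun x => \int[mu]_(y in ball x e) cst 1 (x, y)).
  apply/funext => x; rewrite integral_cst ?mul1e//.
  exact: measurable_metric_ball.
by apply: measurable_ball_integral => //; exact: measurable_cst.
Qed.

Lemma measurable_nabla (alpha e : R) (f : T -> R) : (0 < e)%R ->
  measurable_fun setT f -> measurable_fun setT (nabla mu alpha e f).
Proof.
move=> e0 mf; apply: (@measurableT_comp _ _ _ _ _ _ (fun x => x `^ alpha^-1)).
  exact: measurable_poweR.
apply: emeasurable_funM.
  have -> : (fun x => (mu (ball x e))^-1) =
            (fun x => mu (ball x e) `^ (-1)%R).
    apply/funext => x; have /andP[m0 moo] := ball_fin x e0.
    rewrite -(@fineK _ (mu (ball x e))) ?ge0_fin_numE//.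
    rewrite inver gt_eqF ?fine_gt0 ?m0// poweR_EFin.
    by rewrite powR_inv1// fine_ge0// ltW.
  apply: (@measurableT_comp _ _ _ _ _ _ (fun x => x `^ (-1)%R)).
    exact: measurable_poweR.
  exact: measurable_mu_ball.
apply: (@measurable_ball_integral e
  (fun xy => (`|f xy.1 - f xy.2| `^ alpha)%:E)).
  by move=> xy; rewrite lee_fin powR_ge0.
apply/measurable_EFinP.
apply: (@measurableT_comp _ _ _ _ _ _ (fun x : R => x `^ alpha)%R).
  exact: measurable_powR.
apply: measurableT_comp => //; apply: measurable_funB.
  by apply: measurableT_comp.
by apply: measurableT_comp.
Qed.

End NablaMeasurable.

(** * Series with power weights *)

Section Sums.
Context (R : realType).
Local Open Scope ring_scope.
Implicit Types (u w : nat -> R).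

(** This is the mean value inequality for [x |-> x^(-e)], in the form that makes
    the p-series telescope; it reduces to [1/(x+1) <= ln (x+1) - ln x]. *)
Lemma powR_telescope (x e : R) : 0 < x -> 0 < e ->
  e * (x + 1) `^ (- (1 + e)) <= x `^ (- e) - (x + 1) `^ (- e).
Proof.
move=> x0 e0; have y0 : 0 < x + 1 by rewrite addr_gt0.
have hln : (x + 1)^-1 <= ln (x + 1) - ln x.
  have := @le_ln1Dx R (- (x + 1)^-1).
  have -> : 1 + - (x + 1)^-1 = x / (x + 1) by field; rewrite gt_eqF.
  rewrite ln_div ?posrE// ltrN2 invf_lt1// ltrDr => /(_ x0).
  by rewrite lerNr opprB.
have -> : x `^ (- e) = (x + 1) `^ (- e) * expR (e * (ln (x + 1) - ln x)).
  by rewrite /powR !gt_eqF// -expRD mulrBr !mulNr addKr.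
have -> : (x + 1) `^ (- (1 + e)) = (x + 1) `^ (- e) * (x + 1)^-1.
  rewrite opprD (addrC (- 1)) powRD; last by rewrite (gt_eqF y0) implybT.
  by rewrite powR_inv1// ltW.
rewrite -[X in _ <= _ - X]mulr1 -mulrBr mulrCA.
rewrite ler_wpM2l ?powR_ge0// lerBrDl.
apply: le_trans (expR_ge1Dx _).
by rewrite lerD2l ler_wpM2l// ltW.
Qed.

Lemma p_series_bounded (th : R) : 1 < th ->
  exists K, forall N, \sum_(k < N) (k.+1%:R : R) `^ (- th) <= K.
Proof.
move=> th1; pose e := th - 1; have e0 : 0 < e by rewrite subr_gt0.
exists (1 + e^-1).
have key N : \sum_(k < N.+1) (k.+1%:R : R) `^ (- th) <=
    1 + e^-1 * (1 - (N.+1%:R : R) `^ (- e)).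
  elim: N => [|N IH].
    by rewrite big_ord_recr big_ord0 /= !powR1 subrr mulr0 add0r addr0.
  rewrite big_ord_recr /=; apply: le_trans (lerD IH (lexx _)) _.
  have := @powR_telescope N.+1%:R e (ltr0Sn _ _) e0.
  rewrite natr1 (_ : 1 + e = th) /e; last by ring.
  rewrite -(ler_pM2l (_ : 0 < e^-1)) ?invr_gt0// mulKf ?gt_eqF//.
  rewrite -/e !mulrBr; lra.
case=> [|N].
  by rewrite big_ord0 addr_ge0// invr_ge0 ltW.
apply: le_trans (key N) _.
by rewrite lerD2l ger_pMr ?invr_gt0// gerBl powR_ge0.
Qed.

Lemma powR_le_expR (a c : R) : 0 < c ->
  exists2 C, 0 < C & forall x, 1 <= x -> x `^ a <= C * expR (c * x).
Proof.
move=> c0; have [a0|a0] := leP a 0.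
  exists 1 => // x x1; rewrite mul1r.
  apply: (@le_trans _ _ 1).
    by rewrite -[leRHS](powRr0 x) ler_powR.
  by rewrite -expR0 ler_expR mulr_ge0// ?ltW// (lt_le_trans _ x1).
exists ((a / c) `^ a) => [|x x1]; first by rewrite powR_gt0 ?divr_gt0.
have x0 : 0 <= x by apply: le_trans x1.
have -> : expR (c * x) = expR (c * x / a) `^ a.
  by rewrite -expRM divfK ?gt_eqF.
have ac : 0 <= a / c by rewrite divr_ge0 ?(ltW a0) ?(ltW c0).
have y0 : 0 <= expR (c * x / a) by exact: expR_ge0.
rewrite -powRM//.
apply: ge0_ler_powR; rewrite ?nnegrE ?(ltW a0) ?(mulr_ge0 ac y0)//.
have := expR_ge1Dx (c * x / a).
set y := expR _ => hy; have {}hy : c * x / a <= y by lra.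
have -> : x = (a / c) * (c * x / a) by field; rewrite !gt_eqF.
by rewrite ler_wpM2l.
Qed.

Lemma geometric_powR_bounded (h B : R) : 0 < h ->
  exists K, forall N,
    \sum_(k < N) 2 `^ (- (k.+1%:R * h)) * (k.+1%:R : R) `^ B <= K.
Proof.
move=> h0; have l2 : 0 < ln 2 :> R by rewrite ln_gt0// ltr1n.
have [C C0 hC] := @powR_le_expR (B + 2) (h * ln 2) (mulr_gt0 h0 l2).
have [K hK] := @p_series_bounded 2 (ltac:(by rewrite ltr1n)).
exists (C * K) => N; apply: le_trans (ler_wpM2l (ltW C0) (hK N)).
rewrite mulr_sumr; apply: ler_sum => k _.
set x : R := k.+1%:R; have x1 : 1 <= x by rewrite ler1n.
have x0 : 0 < x by apply: lt_le_trans x1.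
have -> : x `^ B = x `^ (B + 2) * x `^ (- 2).
  by rewrite -powRD ?addrK// (gt_eqF x0) implybT.
rewrite mulrA ler_wpM2r ?powR_ge0//.
rewrite powRN mulrC ler_pdivrMr ?powR_gt0//.
apply: le_trans (hC _ x1) _.
by rewrite ler_wpM2l ?(ltW C0)// /powR gt_eqF//= ler_expR; lra.
Qed.

(** For a nonnegative sequence this bounds the [q]-th power of its l^q
    quasi-norm by [K] if [q] is finite, and its supremum by [K] otherwise. *)
Definition lq_bounded (q : \bar R) (K : R) u : Prop :=
  if q is r%:E then forall N, \sum_(k < N) u k `^ r <= K
  else forall k, u k <= K.

Lemma lq_bounded_le (q : \bar R) (K : R) u : (0 < q)%E ->
  (forall k, 0 <= u k) -> lq_bounded q K u ->
  forall k, u k <= if q is r%:E then K `^ r^-1 else K.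
Proof.
case: q => [r|//|//]; rewrite lte_fin => r0 u0 uK k.
have kr : u k `^ r <= K.
  apply: le_trans (uK k.+1); rewrite big_ord_recr /= lerDr.
  by apply: sumr_ge0 => i _; exact: powR_ge0.
rewrite -(powRr1 (u0 k)) -(mulfV (lt0r_neq0 r0)) powRrM.
apply: ge0_ler_powR; rewrite ?invr_ge0 ?nnegrE ?powR_ge0 ?(ltW r0)//.
by apply: le_trans kr; rewrite powR_ge0.
Qed.

Lemma sum_mul_bounded_l1 (q : \bar R) (K W : R) w : (0 < q)%E ->
  (forall k, 0 <= w k) -> (forall N, \sum_(k < N) w k <= W) ->
  exists C, forall u, (forall k, 0 <= u k) -> lq_bounded q K u ->
    forall N, \sum_(k < N) u k * w k <= C.
Proof.
move=> q0 w0 wW; exists ((if q is r%:E then K `^ r^-1 else K) * W) => u u0 uK N.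
set M := (X in X * W); have uM k : u k <= M by exact: lq_bounded_le uK k.
have M0 : 0 <= M by apply: le_trans (uM 0%N).
apply: le_trans (ler_wpM2l M0 (wW N)); rewrite mulr_sumr.
by apply: ler_sum => k _; exact: ler_wpM2r.
Qed.

(** For [r <= 1] the space l^r embeds in l^1: a sequence in l^r is bounded, so
    [u k] is at most a constant times [u k ^ r]. *)
Lemma sum_mul_bounded_le1 (r K W : R) w : 0 < r <= 1 ->
  (forall k, 0 <= w k <= W) ->
  exists C, forall u, (forall k, 0 <= u k) -> lq_bounded r%:E K u ->
    forall N, \sum_(k < N) u k * w k <= C.
Proof.
move=> /andP[r0 r1] wW; pose M := K `^ r^-1.
exists (M `^ (1 - r) * W * K) => u u0 uK N.
have uM k : u k <= M by exact: (@lq_bounded_le r%:E) uK k.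
have M0 : 0 <= M by apply: le_trans (uM 0%N).
have W0 : 0 <= W by have /andP[h /(le_trans h)] := wW 0%N.
have MW : 0 <= M `^ (1 - r) * W by rewrite mulr_ge0// powR_ge0.
apply: le_trans (ler_wpM2l MW (uK N)); rewrite mulr_sumr.
apply: ler_sum => k _; have /andP[wk0 wkW] := wW k.
have uE : u k = u k `^ (1 - r) * u k `^ r.
  have [uk0|uk0] := eqVneq (u k) 0.
    by rewrite uk0 (powR0 (lt0r_neq0 r0)) mulr0.
  by rewrite -powRD ?uk0 ?implybT// subrK powRr1.
rewrite [X in X * _]uE mulrAC ler_wpM2r ?powR_ge0// ler_pM ?powR_ge0//.
by apply: ge0_ler_powR; rewrite ?subr_ge0 ?nnegrE.
Qed.

(** Young's inequality with crude constants, by comparing [a] with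
    [c ^ (1 / (r - 1))]; it serves as Hoelder's inequality for sums bounded by
    unspecified constants. *)
Lemma young_crude (a c r : R) : 0 <= a -> 0 <= c -> 1 < r ->
  a * c <= a `^ r + c `^ (r / (r - 1)).
Proof.
move=> a0 c0 r1; have r10 : 0 < r - 1 by rewrite subr_gt0.
have [c00|cn0] := eqVneq c 0.
  by rewrite c00 mulr0 addr_ge0 ?powR_ge0.
have cp : 0 < c by rewrite lt0r cn0.
have [ac|ca] := leP a (c `^ (r - 1)^-1).
  rewrite ler_wpDl ?powR_ge0//.
  apply: le_trans (ler_wpM2r c0 ac) _.
  rewrite -[X in _ * X](powRr1 c0) -powRD ?cn0 ?implybT//.
  suff -> : (r - 1)^-1 + 1 = r / (r - 1) by [].
  by field; rewrite gt_eqF.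
rewrite ler_wpDr ?powR_ge0//.
have an0 : a != 0 by rewrite gt_eqF// (le_lt_trans _ ca)// powR_ge0.
have ca' : c <= a `^ (r - 1).
  rewrite -(powRr1 c0) -[X in c `^ X](mulVf (lt0r_neq0 r10)) powRrM.
  by apply: ge0_ler_powR; rewrite ?nnegrE ?powR_ge0 ?(ltW r10) ?(ltW ca).
apply: le_trans (ler_wpM2l a0 ca') _.
by rewrite -[X in X * _](powRr1 a0) -powRD ?an0 ?implybT// addrC subrK.
Qed.

Lemma sum_mul_bounded_gt1 (r K W : R) w : 1 < r ->
  (forall k, 0 <= w k) -> (forall N, \sum_(k < N) w k `^ (r / (r - 1)) <= W) ->
  exists C, forall u, (forall k, 0 <= u k) -> lq_bounded r%:E K u ->
    forall N, \sum_(k < N) u k * w k <= C.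
Proof.
move=> r1 w0 wW; exists (K + W) => u u0 uK N.
apply: le_trans (lerD (uK N) (wW N)); rewrite -big_split /=.
by apply: ler_sum => k _; exact: young_crude.
Qed.

End Sums.

(** * Lower bounds for Lorentz-Zygmund norms *)

Section LorentzZygmundBounds.
Context (R : realType).

Import HBNNSimple.

Lemma le_poweR (x y : \bar R) (r : R) : (0 <= r)%R -> 0 <= x -> x <= y ->
  x `^ r <= y `^ r.
Proof.
move=> r0 x0 xy; apply: gt0_ler_poweR => //; rewrite in_itv/= leey andbT//.
exact: le_trans xy.
Qed.

(** The integral of a nonnegative function is a supremum over the simple
    functions below it, hence monotone without any measurability.  This is used
    for moduli of smoothness, as functions of the radius, whose measurability is
    not clear. *)
Lemma le_lower_integral (d : measure_display) (T : measurableType d)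
    (mu : {measure set T -> \bar R}) (D : set T) (g h : T -> \bar R) :
  (forall x, D x -> 0 <= g x) -> (forall x, D x -> g x <= h x) ->
  \int[mu]_(x in D) g x <= \int[mu]_(x in D) h x.
Proof.
move=> g0 gh; have h0 x : D x -> 0 <= h x.
  by move=> Dx; apply: le_trans (gh _ Dx); exact: g0.
rewrite !ge0_integralE//; apply: ereal_sup_le => _ [k kg <-].
exists k => //= x.
apply: le_trans (kg x) _; rewrite /patch; case: ifPn => //.
by rewrite inE => /gh.
Qed.

Lemma le_integral_itv (a b c : R) (D : set R) (h : R -> \bar R) :
  (a <= b)%R -> (0 <= c)%R -> `[a, b[ `<=` D -> measurable D ->
  (forall x, D x -> 0 <= h x) ->
  (forall x, (a <= x < b)%R -> c%:E <= h x) ->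
  (c * (b - a))%:E <= \int[lebesgue_measure]_(x in D) h x.
Proof.
move=> ab c0 sD mD h0 ch.
have -> : (c * (b - a))%:E =
    \int[lebesgue_measure]_(x in D) ((cst c%:E) \_ `[a, b[) x.
  rewrite -integral_mkcondr setIidr//= integral_cst//=.
  rewrite lebesgue_measure_itv/= lte_fin; case: ltP => [//|ba].
  have -> : a = b by apply/eqP; rewrite eq_le ab.
  by rewrite subrr mulr0 mule0.
apply: le_lower_integral => x Dx.
  by rewrite /patch; case: ifPn => //; rewrite lee_fin.
rewrite /patch; case: ifPn => [|_]; last exact: h0.
by rewrite inE /= in_itv /=; exact: ch.
Qed.

Lemma lnp_half (t u : R) : (0 < t <= 1)%R -> (t / 2 <= u <= t)%R ->
  (1 + lnp t^-1 <= 1 + lnp u^-1 <= 2 * (1 + lnp t^-1))%R.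
Proof.
move=> /andP[t0 t1] /andP[tu ut].
have u0 : (0 < u)%R by apply: lt_le_trans tu; rewrite divr_gt0.
have lt0 : (0 <= - ln t)%R by rewrite oppr_ge0 ln_le0.
have lu0 : (0 <= - ln u)%R by rewrite oppr_ge0 ln_le0// (le_trans ut).
rewrite /lnp !lnV ?posrE// !max_r//.
have h1 : (ln u <= ln t)%R by rewrite ler_ln ?posrE.
have h2 : (ln t - ln 2 <= ln u)%R.
  by rewrite -ln_div ?posrE// ler_ln ?posrE ?divr_gt0.
have h3 : (ln 2 <= 1 :> R)%R.
  have := @le_ln1Dx R 1 (ltac:(by rewrite ltrN10 || lra)).
  by rewrite (_ : 1 + 1 = 2)%R.
by apply/andP; split; lra.
Qed.

(** The factor covers both signs of [a]: for [a >= 0] the power is increasing,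
    for [a < 0] it loses at most [c ^ a]. *)
Lemma powR_ge_min_comparable (a x y c : R) :
  (0 < x)%R -> (x <= y <= c * x)%R -> (1 <= c)%R ->
  (Num.min 1 (c `^ a) * x `^ a <= y `^ a)%R.
Proof.
move=> x0 /andP[xy yc] c1; have c0 : (0 < c)%R by apply: lt_le_trans c1.
have y0 : (0 < y)%R by apply: lt_le_trans xy.
have [a0|a0] := leP 0%R a.
  apply: (@le_trans _ _ (x `^ a)%R).
    by rewrite ler_piMl ?powR_ge0// ge_min lexx.
  by apply: ge0_ler_powR; rewrite ?nnegrE// ltW.
apply: (@le_trans _ _ (c `^ a * x `^ a)%R).
  by rewrite ler_wpM2r ?powR_ge0// ge_min lexx orbT.
rewrite -powRM ?(ltW c0) ?(ltW x0)//.
rewrite -(opprK a) powRN (powRN _ (- a)).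
have cx0 : (0 < c * x)%R by rewrite mulr_gt0.
rewrite lef_pV2 ?posrE ?powR_gt0//.
by apply: ge0_ler_powR; rewrite ?nnegrE ?(ltW y0) ?(ltW cx0)// oppr_ge0 ltW.
Qed.

Lemma LZ_weight_half (p beta : R) : (0 < p)%R ->
  exists2 c : R, (0 < c)%R & forall t u : R, (0 < t <= 1)%R ->
    (t / 2 <= u <= t)%R -> (c * LZ_weight p beta t <= LZ_weight p beta u)%R.
Proof.
move=> p0; exists ((2^-1) `^ p^-1 * Num.min 1 (2 `^ beta))%R.
  by rewrite mulr_gt0 ?powR_gt0// lt_min ltr01 powR_gt0.
move=> t u t01 tu; have /andP[t0 t1] := t01; have /andP[tu1 ut] := tu.
have L0 : (0 < 1 + lnp t^-1)%R by rewrite ltr_wpDr// /lnp le_max lexx.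
rewrite /LZ_weight mulrACA; apply: ler_pM.
- by rewrite mulr_ge0 ?powR_ge0.
- by rewrite mulr_ge0 ?powR_ge0// le_min ler01 powR_ge0.
- rewrite -powRM ?(ltW t0)//; apply: ge0_ler_powR.
  + by rewrite invr_ge0 ltW.
  + by rewrite nnegrE mulr_ge0 ?(ltW t0).
  + by rewrite nnegrE (le_trans _ tu1)// divr_ge0// ltW.
  + by rewrite mulrC.
- apply: powR_ge_min_comparable => //; first exact: lnp_half.
  by rewrite ler1n.
Qed.

Context (d : measure_display) (T : measurableType d).
Variable mu : {measure set T -> \bar R}.

Lemma rearrangement_ge0 (g : T -> \bar R) (t : R) : 0 <= rearrangement mu g t.
Proof. by apply/ereal_infP => _ [s [s0 _] <-]; rewrite lee_fin. Qed.

Lemma rearrangement_ge (g : T -> \bar R) (v t u : R) : (u <= t)%R ->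
  (forall sigma : R, (0 <= sigma < v)%R ->
     t%:E < mu [set x | sigma%:E < `|g x|]) ->
  v%:E <= rearrangement mu g u.
Proof.
move=> ut h; apply/ereal_infP => _ [s [s0 hs] <-].
rewrite lee_fin leNgt; apply/negP => sv.
have := h s; rewrite s0 sv => /(_ isT); apply/negP; rewrite -leNgt.
by apply: le_trans hs _; rewrite lee_fin.
Qed.

Lemma LZ_norm_ge0 (p : R) (r : \bar R) (beta : R) (g : T -> \bar R) :
  0 < r -> 0 <= LZ_norm mu p r beta g.
Proof.
case: r => [r|_|//] /=; first by rewrite poweR_ge0.
apply: (@le_trans _ _ ((LZ_weight p beta 1)%:E * rearrangement mu g 1)).
  by rewrite mule_ge0 ?rearrangement_ge0// lee_fin mulr_ge0 ?powR_ge0.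
by apply: ereal_sup_ubound; exists 1%R => //=.
Qed.

(** The rearrangement is nonincreasing, so it is at least [v] on [[t/2, t]],
    where the weight is comparable with its value at [t]. *)
Lemma LZ_norm_ge (p : R) (r : \bar R) (beta : R) : (0 < p)%R -> 0 < r ->
  exists2 c : R, (0 < c)%R & forall (g : T -> \bar R) (t v : R),
    (0 < t <= 1)%R -> (0 <= v)%R ->
    (forall sigma : R, (0 <= sigma < v)%R ->
       t%:E < mu [set x | sigma%:E < `|g x|]) ->
    (c * LZ_weight p beta t * v)%:E <= LZ_norm mu p r beta g.
Proof.
move=> p0; case: r => [r|_|//]; last first.
  exists 1%R => // g t v /andP[t0 t1] v0 h; rewrite mul1r EFinM.
  apply: (@le_trans _ _ ((LZ_weight p beta t)%:E * rearrangement mu g t)).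
    apply: lee_wpmul2l; first by rewrite lee_fin mulr_ge0 ?powR_ge0.
    exact: rearrangement_ge h.
  by apply: ereal_sup_ubound; exists t.
rewrite lte_fin => r0; have [c c0 hc] := LZ_weight_half beta p0.
exists (c * (2^-1) `^ r^-1)%R; first by rewrite mulr_gt0 ?powR_gt0.
move=> g t v t01 v0 h; have /andP[t0 t1] := t01.
set W := LZ_weight p beta t.
have W0 : (0 <= W)%R by rewrite mulr_ge0 ?powR_ge0.
have cWv : (0 <= c * W * v)%R by rewrite mulr_ge0// mulr_ge0// ltW.
have -> : (c * (2^-1) `^ r^-1 * W * v =
    ((c * W * v) `^ r * t^-1 * (t - t / 2)) `^ r^-1)%R.
  have -> : ((c * W * v) `^ r * t^-1 * (t - t / 2) = (c * W * v) `^ r / 2)%R.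
    have -> : (t - t / 2 = t / 2)%R by lra.
    by rewrite -mulrA mulKf// gt_eqF.
  rewrite powRM ?powR_ge0// -powRrM mulfV ?gt_eqF// powRr1//.
  by set H := (_ `^ r^-1)%R; ring.
rewrite /= -poweR_EFin; apply: le_poweR; rewrite ?invr_ge0 ?(ltW r0)//.
  have t2 : (0 <= t - t / 2)%R by lra.
  by rewrite lee_fin !mulr_ge0 ?powR_ge0 ?invr_ge0 ?(ltW t0).
have th : (t / 2 <= t)%R by lra.
apply: le_integral_itv => //.
- by rewrite mulr_ge0 ?powR_ge0// invr_ge0 ltW.
- move=> x /=; rewrite !in_itv/= andbT => /andP[tx _].
  by apply: lt_le_trans tx; lra.
- move=> x /=; rewrite in_itv/= andbT => x0.
  by rewrite mule_ge0 ?poweR_ge0// lee_fin invr_ge0 ltW.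
- move=> x /andP[tx xt]; rewrite EFinM; apply: lee_pmul.
  + by rewrite lee_fin powR_ge0.
  + by rewrite lee_fin invr_ge0 ltW.
  + rewrite -poweR_EFin; apply: le_poweR; rewrite ?(ltW r0)//.
    * rewrite EFinM; apply: lee_pmul.
      - by rewrite lee_fin mulr_ge0// ltW.
      - by rewrite lee_fin.
      - by rewrite lee_fin hc// tx ltW.
      - by apply: rearrangement_ge h; exact: ltW.
  + by rewrite lee_fin lef_pV2 ?posrE// ?(ltW xt)//; apply: lt_le_trans tx; lra.
Qed.

End LorentzZygmundBounds.

(** * Superlevel sets and averaged differences *)

Lemma measurable_superlevel (d : measure_display) (R : realType)
    (T : measurableType d) (f : T -> R) (a : R) :
  measurable_fun setT f -> measurable [set y | (a < `|f y|)%R].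
Proof.
move=> mf.
have mn : measurable_fun setT (fun y => `|f y|)%R by exact: measurableT_comp.
have -> : [set y | (a < `|f y|)%R] =
    setT `&` (fun y => `|f y|)%R @^-1` [set` `]a, +oo[].
  by apply/seteqP; split => y /=; rewrite in_itv/= andbT; [|case].
exact: mn.
Qed.

Section LevelSets.
Context (d : measure_display) (R : realType) (T : borelMetricType d R).
Variable mu : {measure set T -> \bar R}.
Hypothesis ball_fin : forall (x : T) (e : R), (0 < e)%R ->
  0 < mu (ball x e) < +oo.

(** At most half of the ball can meet the superlevel set of [lam], and on the
    other half [|f x - f y|] is at least [del]. *)
Lemma nabla_ge (f : T -> R) (alpha rho tau lam del : R) (x : T) :
  measurable_fun setT f -> (0 < alpha)%R -> (0 < rho)%R -> (0 <= del)%R ->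
  (2 * tau)%:E <= mu (ball x rho) ->
  mu [set y | (lam < `|f y|)%R] <= tau%:E ->
  (lam + del < `|f x|)%R ->
  ((2^-1) `^ alpha^-1 * del)%:E <= nabla mu alpha rho f x.
Proof.
move=> mf a0 rho0 del0 Btau lamtau fx.
set bad := [set y | (lam < `|f y|)%R] in lamtau.
have mbad : measurable bad by exact: measurable_superlevel.
have mB : measurable (ball x rho) by exact: measurable_metric_ball.
have /andP[B0 Boo] := ball_fin x rho0.
have [b bE] : exists b : R, mu (ball x rho) = b%:E.
  by exists (fine (mu (ball x rho))); rewrite fineK ?ge0_fin_numE.
rewrite bE lte_fin in B0; rewrite bE lee_fin in Btau.
have goodge : (b / 2)%:E <= mu (ball x rho `\` bad).
  rewrite measureD//= bE leeBrDr; last first.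
    rewrite ge0_fin_numE// (le_lt_trans _ Boo)// le_measure ?inE//.
    exact: measurableI.
  apply: (@le_trans _ _ ((b / 2)%:E + tau%:E)).
    apply: leeD => //; apply: le_trans lamtau; apply: le_measure => //.
    - by rewrite inE; exact: measurableI.
    - by rewrite inE.
  by rewrite -EFinD lee_fin; lra.
have intge : ((del `^ alpha) * (b / 2))%:E <=
    \int[mu]_(y in ball x rho) (`|f x - f y| `^ alpha)%:E.
  apply: (@le_trans _ _ (\int[mu]_(y in ball x rho)
      ((cst (del `^ alpha)%:E) \_ (ball x rho `\` bad)) y)).
    rewrite -integral_mkcondr setIidr; last by move=> y [].
    rewrite integral_cst/=; last exact: measurableD.
    by rewrite EFinM; apply: lee_wpmul2l; rewrite ?lee_fin ?powR_ge0.
  apply: le_lower_integral => y yB; rewrite /patch; case: ifPn => // hy;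
    rewrite lee_fin ?powR_ge0//.
  apply: ge0_ler_powR; rewrite ?nnegrE ?(ltW a0)//.
  move: hy; rewrite inE => -[_ /negP]; rewrite -leNgt => hy.
  have := lerB_dist (f x) (f y); lra.
rewrite /nabla bE.
have -> : ((2^-1) `^ alpha^-1 * del =
    (b^-1 * (del `^ alpha * (b / 2))) `^ alpha^-1)%R.
  have -> : (b^-1 * (del `^ alpha * (b / 2)) = 2^-1 * del `^ alpha)%R.
    by field; rewrite gt_eqF.
  by rewrite powRM ?powR_ge0// -powRrM mulfV ?gt_eqF// powRr1.
rewrite -poweR_EFin; apply: le_poweR.
- by rewrite invr_ge0 ltW.
- rewrite lee_fin mulr_ge0 ?invr_ge0 ?(ltW B0)//.
  by rewrite mulr_ge0 ?powR_ge0 ?divr_ge0 ?(ltW B0).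
- rewrite EFinM; apply: lee_pmul => //.
  + by rewrite lee_fin invr_ge0 ltW.
  + by rewrite lee_fin mulr_ge0 ?powR_ge0 ?divr_ge0 ?(ltW B0).
  + by rewrite inver gt_eqF.
Qed.

(** The pointwise bound of [nabla_ge] holds on a set of measure larger than [t],
    which is what the rearrangement of [nabla f] measures. *)
Lemma LZ_modulus_ge (alpha p : R) (r : \bar R) (beta : R) :
  (0 < alpha)%R -> (0 < p)%R -> 0 < r ->
  exists2 c : R, (0 < c)%R &
    forall (f : T -> R) (rho tau lam del t : R), measurable_fun setT f ->
      (0 < rho)%R -> (0 <= del)%R -> (0 < t <= 1)%R ->
      (forall x, (2 * tau)%:E <= mu (ball x rho)) ->
      mu [set y | (lam < `|f y|)%R] <= tau%:E ->
      t%:E < mu [set y | (lam + del < `|f y|)%R] ->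
      (c * LZ_weight p beta t * del)%:E <= LZ_modulus mu alpha p r beta f rho.
Proof.
move=> a0 p0 r0; have [c c0 hc] := LZ_norm_ge mu beta p0 r0.
exists (c * (2^-1) `^ alpha^-1)%R; first by rewrite mulr_gt0 ?powR_gt0.
move=> f rho tau lam del t mf rho0 del0 t01 Btau lamtau tlt.
have := hc (nabla mu alpha rho f) t ((2^-1) `^ alpha^-1 * del)%R t01.
have -> : (c * LZ_weight p beta t * ((2^-1) `^ alpha^-1 * del) =
  c * (2^-1) `^ alpha^-1 * LZ_weight p beta t * del)%R.
  by set H := (_ `^ alpha^-1)%R; ring.
apply; first by rewrite mulr_ge0 ?powR_ge0.
move=> sigma /andP[s0 sv]; apply: lt_le_trans tlt _; apply: le_measure.
- by rewrite inE; exact: measurable_superlevel.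
- rewrite inE; have -> : [set x | sigma%:E < `|nabla mu alpha rho f x|] =
      setT `&` (abse \o nabla mu alpha rho f) @^-1` [set` `]sigma%:E, +oo]].
    by apply/seteqP; split => y /=; rewrite in_itv/= leey andbT; [|case].
  have mn : measurable_fun setT (abse \o nabla mu alpha rho f).
    by apply: measurableT_comp => //; exact: measurable_nabla.
  by apply: mn => //; exact: emeasurable_itv.
- move=> x /= fx; apply: lt_le_trans (lee_abs _).
  apply: lt_le_trans (nabla_ge mf a0 rho0 del0 (Btau x) lamtau fx).
  by rewrite lte_fin.
Qed.

End LevelSets.

(** * Besov seminorms over dyadic radii *)

Section DyadicRadii.
Context (R : realType).

Definition rad (k : nat) : R := 2 `^ (- k%:R).

Lemma rad_gt0 k : (0 < rad k)%R. Proof. exact: powR_gt0. Qed.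

Lemma radS k : (rad k.+1 = rad k / 2)%R.
Proof.
rewrite /rad -(@natr1 _ k) opprD powRD; last first.
  by rewrite (gt_eqF (ltr0Sn _ _)) implybT.
by rewrite powR_inv1.
Qed.

Lemma rad_mono j k : (j <= k)%N -> (rad k <= rad j)%R.
Proof. by move=> jk; rewrite /rad ler_powR ?ler1n// lerN2 ler_nat. Qed.

Definition radii (k : nat) : set R := [set` `[rad k.+1, rad k[].

Lemma measurable_radii k : measurable (radii k).
Proof. exact: measurable_itv. Qed.

Lemma lebesgue_measure_radii k :
  lebesgue_measure (radii k) = (rad k / 2)%:E.
Proof.
have r0 := rad_gt0 k.
rewrite /radii lebesgue_measure_itv/= lte_fin radS ifT; last by lra.
by rewrite -EFinB; congr EFin; lra.
Qed.

Lemma radii_disjoint j k x : radii j x -> radii k x -> j = k.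
Proof.
wlog jk : j k / (j <= k)%N => [H xj xk|].
  by case: (leqP j k) => [/H|/ltnW /H]; [exact|move=> h; apply/esym/h].
rewrite /radii /= !in_itv/= => /andP[xj _] /andP[_ xk].
move: jk; rewrite leq_eqVlt => /orP[/eqP//|/rad_mono h].
by have := lt_le_trans xk (le_trans h xj); rewrite ltxx.
Qed.

(** The functional of the modulus of smoothness that defines the Besov seminorm,
    for an arbitrary function of the radius. *)
Definition scale_norm (s : R) (q : \bar R) (E : R -> \bar R) : \bar R :=
  match q with
  | q'%:E =>
      (\int[lebesgue_measure]_(rho in `]0%R, +oo[)
         (((rho `^ (- s))%:E * E rho) `^ q' * (rho^-1)%:E)) `^ q'^-1
  | +oo => ereal_sup [set (rho `^ (- s))%:E * E rho
                     | rho in [set rho : R | (0 < rho)%R]]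
  | -oo => 0
  end.

Lemma scale_norm_ge0 (s : R) (q : \bar R) (E : R -> \bar R) : 0 < q ->
  (forall rho, 0 <= E rho) -> 0 <= scale_norm s q E.
Proof.
case: q => [q|_|//] E0 /=; first by rewrite poweR_ge0.
apply: (@le_trans _ _ ((1 `^ (- s))%:E * E 1%R)).
  by rewrite mule_ge0// lee_fin powR_ge0.
by apply: ereal_sup_ubound; exists 1%R => //=.
Qed.

(** On the [k]-th interval the integrand is at least the [q]-th power of
    [rad k ^ (- s) * v k] times [1 / rad k], and the interval has length
    [rad k / 2].  This is where the constant [2] comes from; for [q] infinite
    the bound is even [1]. *)
Lemma scale_norm_lq_bounded (s : R) (q : \bar R) (E : R -> \bar R)
    (v : nat -> R) (M : R) : (0 < s)%R -> 0 < q -> (0 < M)%R ->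
  (forall rho, 0 <= E rho) -> (forall k, 0 <= v k)%R ->
  (forall k rho, radii k rho -> (v k)%:E <= E rho) ->
  scale_norm s q E <= M%:E ->
  lq_bounded q 2 (fun k => rad k `^ (- s) * v k / M)%R.
Proof.
move=> s0 + M0 E0 v0 vE.
have radE k rho : radii k rho ->
    (rad k `^ (- s) * v k)%:E <= (rho `^ (- s))%:E * E rho.
  move=> rk; have := rk; rewrite /radii /= in_itv/= => /andP[r1 r2].
  have rho0 : (0 < rho)%R by apply: lt_le_trans r1; exact: rad_gt0.
  rewrite EFinM; apply: lee_pmul; rewrite ?lee_fin ?powR_ge0//; last exact: vE.
  rewrite !powRN lef_pV2 ?posrE ?powR_gt0 ?rad_gt0//.
  by apply: ge0_ler_powR;
    rewrite ?nnegrE ?(ltW s0) ?(ltW rho0) ?(ltW r2) ?(ltW (rad_gt0 k)).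
have a0 k : (0 <= rad k `^ (- s) * v k)%R by rewrite mulr_ge0 ?powR_ge0.
case: q => [q|_|//]; last first.
  move=> /= hM k; have rk : radii k (rad k.+1).
    by rewrite /radii /= in_itv/= lexx radS; have := rad_gt0 k; lra.
  have h : (rad k `^ (- s) * v k)%:E <= M%:E.
    apply: le_trans (radE k _ rk) _; apply: le_trans hM.
    by apply: ereal_sup_ubound; exists (rad k.+1) => //; exact: rad_gt0.
  rewrite lee_fin in h; rewrite ler_pdivrMr//; lra.
rewrite lte_fin => q0 /= hM N.
set I := integral _ _ _ in hM.
have I0 : 0 <= I.
  apply: integral_ge0 => x /=; rewrite in_itv/= andbT => x0.
  by rewrite mule_ge0 ?poweR_ge0// lee_fin invr_ge0 ltW.
have IM : I <= (M `^ q)%:E.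
  rewrite -(@poweRe1 _ I I0) -(mulVf (lt0r_neq0 q0)) poweRrM -poweR_EFin.
  by apply: le_poweR => //; rewrite ?(ltW q0) ?poweR_ge0.
pose a k := (rad k `^ (- s) * v k)%R.
have sumI : (\sum_(k < N) (a k) `^ q / 2)%:E <= I.
  pose c k := ((a k) `^ q * (rad k)^-1)%R.
  have c0 k : (0 <= c k)%R.
    by rewrite mulr_ge0 ?powR_ge0// invr_ge0 ltW// rad_gt0.
  apply: (@le_trans _ _ (\int[lebesgue_measure]_(x in `]0%R, +oo[)
    (\sum_(k < N) (c k)%:E * (\1_(radii k) x)%:E))).
    rewrite ge0_integral_sum//; last 2 first.
    - move=> k; apply: emeasurable_funM => //; apply/measurable_EFinP.
      by apply: measurable_indic; exact: measurable_radii.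
    - by move=> k x _; rewrite mule_ge0// lee_fin.
    rewrite -sumEFin; apply: lee_sum => k _.
    rewrite ge0_integralZl_EFin//; last first.
      apply/measurable_EFinP; apply: measurable_indic.
      exact: measurable_radii.
    rewrite integral_indic//; last exact: measurable_radii.
    rewrite setIidl; last first.
      move=> x; rewrite /radii /= !in_itv/= andbT => /andP[+ _].
      by apply: lt_le_trans; exact: rad_gt0.
    rewrite [X in _ * X](_ : _ = (rad k / 2)%:E); last first.
      exact: lebesgue_measure_radii.
    rewrite -EFinM lee_fin /c.
    by rewrite -mulrA mulKf// gt_eqF// rad_gt0.
  apply: le_lower_integral => x; rewrite /= in_itv/= andbT => x0.
    by apply: sume_ge0 => k _; rewrite mule_ge0// lee_fin.
  have rhs0 : 0 <= ((x `^ (- s))%:E * E x) `^ q * (x^-1)%:E.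
    by rewrite mule_ge0 ?poweR_ge0// lee_fin invr_ge0 ltW.
  have [[k xk]|nk] := pselect (exists k : 'I_N, radii k x); last first.
    rewrite big1// => k _; rewrite indicE memNset ?mule0// => xk.
    by apply: nk; exists k.
  rewrite (bigD1 k)//= big1 ?adde0; last first.
    move=> j jk; rewrite indicE memNset ?mule0// => xj.
    by move/eqP: jk; apply; apply/val_inj; exact: radii_disjoint xj xk.
  rewrite indicE mem_set// mule1 /c EFinM; apply: lee_pmul.
  - by rewrite lee_fin powR_ge0.
  - by rewrite lee_fin invr_ge0 ltW// rad_gt0.
  - rewrite -poweR_EFin; apply: le_poweR; first exact: ltW.
      by rewrite lee_fin; exact: a0.
    by apply: radE.
  - move: xk; rewrite /radii /= in_itv/= => /andP[_ xk].
    by rewrite lee_fin lef_pV2 ?posrE ?rad_gt0// ltW.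
have := le_trans sumI IM; rewrite lee_fin => h.
have Mq : (0 < M `^ q)%R by rewrite powR_gt0.
have -> : (\sum_(k < N) (rad k `^ (- s) * v k / M) `^ q =
    (M `^ q)^-1 * 2 * \sum_(k < N) (a k) `^ q / 2)%R.
  rewrite mulr_sumr; apply: eq_bigr => k _.
  rewrite powRM ?invr_ge0 ?(ltW M0)// -powR_inv1 ?(ltW M0)//.
  rewrite -powRrM mulN1r (powRN M).
  rewrite /a; set X := (_ `^ q)%R; set Y := ((_ `^ q)^-1)%R; by field.
rewrite -mulrA mulrCA ger_pMr// mulrC ler_pdivrMr ?mul1r//.
Qed.

Lemma sum_rad_le2 N : (\sum_(k < N) rad k <= 2)%R.
Proof.
suff -> : (\sum_(k < N) rad k = 2 - 2 * rad N)%R.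
  by rewrite gerBl mulr_ge0// ltW// rad_gt0.
elim: N => [|N IH]; first by rewrite big_ord0 /rad oppr0 powRr0; lra.
by rewrite big_ord_recr /= IH radS; lra.
Qed.

(** The sequence [v] consists of the infima of [E] over the dyadic intervals.
    They are finite, since an infinite one would allow arbitrarily large values
    of [v k] in [scale_norm_lq_bounded]. *)
Lemma scale_norm_infima (s : R) (q : \bar R) (E : R -> \bar R) (M : R) :
  (0 < s)%R -> 0 < q -> (0 < M)%R -> (forall rho, 0 <= E rho) ->
  scale_norm s q E <= M%:E ->
  exists v : nat -> R, [/\ (forall k, 0 <= v k)%R,
    (forall k x, (forall rho, radii k rho -> x%:E <= E rho) -> (x <= v k)%R) &
    lq_bounded q 2 (fun k => rad k `^ (- s) * v k / M)%R].
Proof.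
move=> s0 q0 M0 E0 hM.
pose a k := ereal_inf [set E rho | rho in radii k].
have a0 k : 0 <= a k by apply/ereal_infP => _ [rho _ <-].
have aE k rho : radii k rho -> a k <= E rho.
  by move=> rk; apply: ereal_inf_lbound; exists rho.
have afin k : a k \is a fin_num.
  rewrite ge0_fin_numE// ltey; apply/negP => /eqP aoo.
  pose B : R := if q is r%:E then (2 `^ r^-1)%R else 2%R.
  pose X : R := (B * M * rad k `^ s + 1)%R.
  have rs : (0 < rad k `^ s)%R by rewrite powR_gt0// rad_gt0.
  have X0 : (0 <= X)%R.
    rewrite addr_ge0// !mulr_ge0 ?(ltW M0) ?(ltW rs)//.
    by rewrite /B; case: (q) => // ?; rewrite powR_ge0.
  (* A single large value already violates the l^q bound. *)
  pose v j : R := if j == k then X else 0%R.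
  have v0 j : (0 <= v j)%R by rewrite /v; case: ifP.
  have vE j rho : radii j rho -> (v j)%:E <= E rho.
    move=> rj; rewrite /v; case: eqP => // jk.
    by have := aE j rho rj; rewrite jk aoo leye_eq => /eqP ->; rewrite leey.
  have hl := scale_norm_lq_bounded s0 q0 M0 E0 v0 vE hM.
  have u0 j : (0 <= rad j `^ (- s) * v j / M)%R.
    by rewrite divr_ge0 ?(ltW M0)// mulr_ge0 ?powR_ge0.
  have := lq_bounded_le q0 u0 hl k.
  rewrite -/B /v eqxx powRN ler_pdivrMr// mulrC ler_pdivrMr//.
  by rewrite /X; lra.
exists (fun k => fine (a k)); split.
- by move=> k; rewrite fine_ge0.
- move=> k x h; rewrite -lee_fin fineK//; apply/ereal_infP => _ [rho rk <-].
  exact: h.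
- apply: (scale_norm_lq_bounded s0 q0 M0 E0) hM => [k|k rho rk].
    by rewrite fine_ge0.
  by rewrite fineK// aE.
Qed.

End DyadicRadii.

(** * Weights and measures of balls along dyadic scales *)

Section Weights.
Context (R : realType).

(** With [h = s - D / p], this is up to a constant the factor by which the
    normalised modulus at radius [2^(-k)] raises the level of [f]. *)
Definition log_weight (h beta : R) (k : nat) : R :=
  (2 `^ (- (k.+1%:R * h)) * k.+1%:R `^ (- beta))%R.

Lemma log_weight_ge0 h beta k : (0 <= log_weight h beta k)%R.
Proof. by rewrite mulr_ge0 ?powR_ge0. Qed.

(** If [h > 0], or if [q] is infinite and hence [beta > 1/g >= 1], the weights
    are summable and [u] is bounded.  Otherwise [h = 0] and the weights are
    powers of [k + 1]; they are bounded if [q <= 1], because then [beta >= 0],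
    and they lie in the dual space l^(q') if [q > 1], because
    [beta > 1/g - 1/q >= 1 - 1/q]. *)
Lemma log_weight_dual (h beta g : R) (q : \bar R) (K : R) :
  (0 < g <= 1)%R -> 0 < q ->
  (0 < h)%R \/ [/\ h = 0%R, (g%:E < q -> g%:E^-1 - q^-1 < beta%:E) &
                   (q <= g%:E -> (0 <= beta)%R)] ->
  exists C : R, forall u : nat -> R, (forall k, 0 <= u k)%R ->
    lq_bounded q K u ->
    forall N, (\sum_(k < N) u k * log_weight h beta k <= C)%R.
Proof.
move=> /andP[g0 g1] q0 [h0|[-> hgq hqg]].
  have [W hW] := geometric_powR_bounded (- beta) h0.
  by apply: (sum_mul_bounded_l1 K q0 _ hW) => k; exact: log_weight_ge0.
have wE k : log_weight 0 beta k = (k.+1%:R `^ (- beta))%R.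
  by rewrite /log_weight mulr0 oppr0 powRr0 mul1r.
have ginv : g%:E^-1 = (g^-1)%:E by rewrite inver gt_eqF.
have ginv1 : (1 <= g^-1)%R by rewrite invf_ge1.
case: q q0 hgq hqg => [q|_|//]; last first.
  rewrite ginv ltry => /(_ isT); rewrite invey sube0 lte_fin => gb _.
  have [W hW] := p_series_bounded (le_lt_trans ginv1 gb).
  apply: (@sum_mul_bounded_l1 _ +oo K W) => // [k|N].
    exact: log_weight_ge0.
  by under eq_bigr do rewrite wE.
rewrite !lte_fin lee_fin => q0; rewrite ginv inver gt_eqF// -EFinB lte_fin.
move=> hgq hqg; have [q1|q1] := leP q 1%R.
  have b0 : (0 <= beta)%R.
    have [gq|/hqg//] := ltP g q.
    apply: le_trans (ltW (hgq gq)); rewrite subr_ge0 lef_pV2 ?posrE//.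
    exact: ltW.
  apply: (@sum_mul_bounded_le1 _ q K 1); first by rewrite q0.
  move=> k; rewrite log_weight_ge0 wE powRN invf_le1 ?powR_gt0//.
  rewrite -[leLHS](powRr0 k.+1%:R) ler_powR//= ?ler1n//.
have {}hgq := hgq (le_lt_trans g1 q1).
have q10 : (0 < q - 1)%R by rewrite subr_gt0.
have bq : (1 < beta * (q / (q - 1)))%R.
  rewrite mulrA ltr_pdivlMr// mul1r -ltr_pdivrMr//.
  rewrite mulrDl mulfV ?gt_eqF// mulN1r; lra.
have [W hW] := p_series_bounded bq.
apply: (@sum_mul_bounded_gt1 _ q K W) => // [k|N]; first exact: log_weight_ge0.
under eq_bigr do rewrite wE -powRrM mulNr.
exact: hW.
Qed.

(** Along the geometric sequence of measures, [1 + ln (1/t)] is an arithmetic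
    progression, hence comparable with [k + 1]. *)
Lemma LZ_weight_dyadic_ge (p beta D t0 : R) : (0 < p)%R -> (0 < D)%R ->
  (0 < t0 <= 1)%R -> exists2 c : R, (0 < c)%R & forall k : nat,
    (c * (2 `^ (- (k.+1%:R * (D / p))) * k.+1%:R `^ beta) <=
     LZ_weight p beta (t0 * 2 `^ (- (k.+1%:R * D))))%R.
Proof.
move=> p0 D0 /andP[t00 t01].
have l2 : (0 < ln 2 :> R)%R by rewrite ln_gt0// ltr1n.
pose m := (D * ln 2)%R; have m0 : (0 < m)%R by rewrite mulr_gt0.
have lt0 : (0 <= - ln t0)%R by rewrite oppr_ge0 ln_le0.
pose m' := (1 - ln t0 + m)%R.
have mm' : (m <= m')%R by rewrite /m'; lra.
pose mn := Num.min 1%R ((m' / m) `^ beta)%R.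
have m'0 : (0 < m')%R by apply: lt_le_trans mm'.
have mn0 : (0 < mn)%R by rewrite lt_min ltr01 powR_gt0// divr_gt0.
exists (t0 `^ p^-1 * (mn * m `^ beta))%R.
  by rewrite mulr_gt0 ?powR_gt0// mulr_gt0 ?powR_gt0.
move=> k; set x : R := k.+1%:R; have x1 : (1 <= x)%R by rewrite ler1n.
have x0 : (0 < x)%R by apply: lt_le_trans x1.
have t2 : (0 < 2 `^ (- (x * D)) :> R)%R by rewrite powR_gt0.
have t20 : (0 < t0 * 2 `^ (- (x * D)))%R by rewrite mulr_gt0.
rewrite /LZ_weight.
have -> : ((t0 * 2 `^ (- (x * D))) `^ p^-1 =
    t0 `^ p^-1 * 2 `^ (- (x * (D / p))))%R.
  by rewrite powRM ?(ltW t00) ?(ltW t2)// -powRrM mulNr mulrA.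
have -> : (1 + lnp (t0 * 2 `^ (- (x * D)))^-1 = 1 - ln t0 + x * m)%R.
  rewrite /lnp lnV ?posrE// lnM ?posrE// ln_powR max_r.
    by rewrite /m; lra.
  have : (0 <= x * D * ln 2)%R.
    by rewrite !mulr_ge0 ?(ltW x0) ?(ltW D0) ?(ltW l2).
  by lra.
rewrite mulrACA ler_pM2l ?mulr_gt0 ?powR_gt0//.
rewrite -mulrA -powRM ?(ltW m0) ?(ltW x0)//.
apply: powR_ge_min_comparable; first by rewrite mulr_gt0.
  rewrite [(m * x)%R]mulrC; apply/andP; split; first lra.
  have -> : (m' / m * (x * m) = m' * x)%R by field; rewrite gt_eqF.
  rewrite /m' mulrDl [(m * x)%R]mulrC lerD2r ler_peMr//; lra.
by rewrite ler_pdivlMr// mul1r.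
Qed.

End Weights.

Section Doubling.
Context (d : measure_display) (R : realType) (T : borelMetricType d R).
Variable mu : {measure set T -> \bar R}.
Hypothesis mu_doubling : doubling_measure mu.

(** The doubling inequality is closed in the constant, so it passes to the
    infimum. *)
Lemma smallest_doubling_constantP :
  (1 <= smallest_doubling_constant mu)%R /\
  forall (x : T) (rho : R), (0 < rho)%R ->
    mu (ball x (2 * rho)%R) <=
    (smallest_doubling_constant mu)%:E * mu (ball x rho).
Proof.
have [ball_fin [C0 hC0]] := mu_doubling.
have ne : doubling_constant mu !=set0 by exists C0.
split; first by apply: lb_le_inf => // C [/ltW].
move=> x rho rho0; have /andP[m0 moo] := ball_fin x rho rho0.
have /andP[M0 Moo] := ball_fin x (2 * rho)%R (mulr_gt0 (ltr0Sn _ _) rho0).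
rewrite -(@fineK _ (mu (ball x rho))) ?ge0_fin_numE//.
rewrite -(@fineK _ (mu (ball x (2 * rho)%R))) ?ge0_fin_numE//.
rewrite -EFinM lee_fin.
have f0 : (0 < fine (mu (ball x rho)))%R by rewrite fine_gt0// m0.
rewrite -ler_pdivrMr//; apply: lb_le_inf => // C [_ /(_ x rho rho0)].
rewrite -(@fineK _ (mu (ball x rho))) ?ge0_fin_numE//.
rewrite -[X in X <= _](@fineK _ (mu (ball x (2 * rho)%R))) ?ge0_fin_numE//.
by rewrite -EFinM lee_fin ler_pdivrMr.
Qed.

Lemma mu_ball_rad_ge (b D : R) : (0 < b)%R ->
  (forall x : T, b%:E <= mu (ball x 1%R)) -> (upper_dimension mu <= D)%R ->
  forall (k : nat) (x : T) (rho : R), (rad R k <= rho)%R ->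
    (b * 2 `^ (- (k%:R * D)))%:E <= mu (ball x rho).
Proof.
move=> b0 hb QD k x rho kr.
have [C1 hC] := smallest_doubling_constantP.
set C := smallest_doubling_constant mu in C1 hC.
have l2 : (0 < ln 2 :> R)%R by rewrite ln_gt0// ltr1n.
have C0 : (0 < C)%R by apply: lt_le_trans C1.
have CD : (C <= 2 `^ D)%R.
  rewrite -ler_ln ?posrE ?powR_gt0// ln_powR -ler_pdivrMr//.
apply: (@le_trans _ _ (mu (ball x (rad R k)))); last first.
  by apply: le_measure; rewrite ?inE;
    [exact: measurable_metric_ball..|exact: le_ball].
elim: k {rho kr} => [|k IH].
  by rewrite mul0r oppr0 /rad oppr0 !powRr0 mulr1.
have := le_trans IH _; rewrite (_ : rad R k = 2 * rad R k.+1)%R; last first.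
  by rewrite radS; lra.
move=> /(_ _ (hC x _ (rad_gt0 R k.+1))) h.
have D2 : (0 < 2 `^ D :> R)%R by rewrite powR_gt0.
rewrite -(@lee_pmul2l _ (2 `^ D)%:E)// -?EFinM ?lte_fin//.
have -> : (2 `^ D * (b * 2 `^ (- (k.+1%:R * D))) = b * 2 `^ (- (k%:R * D)))%R.
  rewrite mulrCA -powRD ?pnatr_eq0 ?implybT//; congr (_ * _ `^ _)%R.
  by rewrite -(@natr1 _ k); ring.
by apply: le_trans h _; apply: lee_wpmul2r => //; rewrite lee_fin.
Qed.

End Doubling.

(** * Superlevel sets and the endpoint norms *)

Section Endgame.
Context (d : measure_display) (R : realType) (T : measurableType d).
Variable mu : {measure set T -> \bar R}.

Lemma sum_norm_ge0 (g : \bar R) (f : T -> R) : 0 <= sum_norm mu g f.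
Proof.
by apply/ereal_infP => _ [f0 [f1 [_ _ _ ->]]]; rewrite adde_ge0 ?Lnorm_ge0.
Qed.

Lemma Lnorm_infty_le (f : T -> R) (K : R) : (0 <= K)%R ->
  measurable_fun setT f -> mu [set y | (K < `|f y|)%R] = 0 ->
  'N[mu]_+oo [EFin \o f] <= K%:E.
Proof.
move=> K0 mf h; rewrite unlock /=; case: ifPn => // _.
apply/ess_supP; exists [set y | (K < `|f y|)%R]; split => //.
  exact: measurable_superlevel.
by move=> y /=; rewrite lee_fin => /negP; rewrite -ltNge.
Qed.

(** Markov's inequality bounds the part of [f] in [L^g], and the bounded part
    stays below [M] almost everywhere. *)
Lemma superlevel_sum_norm (g : R) (f : T -> R) (M t : R) : (0 < g)%R ->
  (0 < M)%R -> (0 < t)%R -> measurable_fun setT f ->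
  0 < mu [set: T] -> sum_norm mu g%:E f < M%:E ->
  mu [set y | ((1 + (t^-1) `^ g^-1) * M < `|f y|)%R] <= t%:E.
Proof.
move=> g0 M0 t0 mf muT /ereal_inf_lt[_ [f0 [f1 [mf0 mf1 ff ->]]] hM].
have N0M : 'N[mu]_g%:E[EFin \o f0] <= M%:E.
  by apply: le_trans (ltW hM); rewrite leeDl ?Lnorm_ge0.
have N1M : 'N[mu]_+oo[EFin \o f1] <= M%:E.
  by apply: le_trans (ltW hM); rewrite leeDr ?Lnorm_ge0.
pose S := ((t^-1) `^ g^-1 * M)%R.
have S0 : (0 < S)%R by rewrite mulr_gt0// powR_gt0 ?invr_gt0.
have A1 : mu [set y | (M < `|f1 y|)%R] = 0.
  move: N1M; rewrite unlock /= muT => /ess_supP[N [mN N0 hN]].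
  apply: (@subset_measure0 _ _ _ mu _ N) => //.
    exact: measurable_superlevel.
  move=> y /= My; apply: hN => /=; rewrite lee_fin; apply/negP.
  by rewrite -ltNge.
have A0 : mu [set y | (S < `|f0 y|)%R] <= t%:E.
  have mA : measurable [set y | (S < `|f0 y|)%R].
    exact: measurable_superlevel.
  have h1 : (S `^ g)%:E * mu [set y | (S < `|f0 y|)%R] <=
      \int[mu]_y (`|(EFin \o f0) y| `^ g).
    rewrite -integral_cst//= integral_mkcond/=.
    apply: le_lower_integral => y _.
      by rewrite /patch; case: ifP => //; rewrite lee_fin powR_ge0.
    rewrite /patch; case: ifPn => [|_]; rewrite lee_fin ?powR_ge0//.
    rewrite inE /= => Sy; apply: ge0_ler_powR; rewrite ?nnegrE ?(ltW g0)//.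
      exact: ltW.
    exact: ltW.
  have h2 : \int[mu]_y (`|(EFin \o f0) y| `^ g) <= (M `^ g)%:E.
    rewrite -poweR_Lnorm ?gt_eqF// -poweR_EFin; apply: le_poweR => //.
      exact: ltW.
    exact: Lnorm_ge0.
  have Sg : (0 < S `^ g)%R by rewrite powR_gt0.
  rewrite -(@lee_pmul2l _ (S `^ g)%:E)//; apply: le_trans h1 (le_trans h2 _).
  rewrite -EFinM lee_fin /S powRM ?powR_ge0 ?(ltW M0)// -powRrM mulVf ?gt_eqF//.
  by rewrite powRr1 ?invr_ge0 ?(ltW t0)// mulrAC mulVf ?gt_eqF// mul1r.
apply: (@le_trans _ _
  (mu ([set y | (S < `|f0 y|)%R] `|` [set y | (M < `|f1 y|)%R]))).
  apply: le_measure; rewrite ?inE.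
  - exact: measurable_superlevel.
  - by apply: measurableU; exact: measurable_superlevel.
  - move=> y /=; rewrite ff mulrDl mul1r -/S => h.
    have [h0|h0] := ltP S `|f0 y|%R; [by left|right].
    by have := ler_normD (f0 y) (f1 y); lra.
apply: le_trans (measureU2 _ _ _) _; [exact: measurable_superlevel..|].
by rewrite -[leRHS]adde0; apply: leeD; [exact: A0|rewrite -A1].
Qed.

Lemma superlevel_iterate (f : T -> R) (t dl : nat -> R) (lam : R) :
  mu [set y | (lam < `|f y|)%R] <= (t 0%N)%:E ->
  (forall k l, mu [set y | (l < `|f y|)%R] <= (t k)%:E ->
     mu [set y | (l + dl k < `|f y|)%R] <= (t k.+1)%:E) ->
  forall N, mu [set y | (lam + \sum_(k < N) dl k < `|f y|)%R] <= (t N)%:E.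
Proof.
move=> h0 hS; elim=> [|N IH]; first by rewrite big_ord0 addr0.
by rewrite big_ord_recr /= addrA; exact: hS.
Qed.

Lemma measure0_of_dyadic (A : set T) (t0 D : R) : (0 < D)%R -> (0 < t0)%R ->
  (forall N : nat, mu A <= (t0 * 2 `^ (- (N%:R * D)))%:E) -> mu A = 0.
Proof.
move=> D0 t00 h; apply/eqP; rewrite eq_le measure_ge0 andbT leNgt.
apply/negP => m0.
have mfin : mu A \is a fin_num.
  by rewrite ge0_fin_numE// (le_lt_trans (h 0%N))// ltry.
rewrite -(fineK mfin) lte_fin in m0; set m := fine _ in m0.
have l2 : (0 < ln 2 :> R)%R by rewrite ln_gt0// ltr1n.
pose e := (D * ln 2)%R; have e0 : (0 < e)%R by rewrite mulr_gt0.
pose N := Num.bound (t0 / (m * e)).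
have me : (0 < m * e)%R by rewrite mulr_gt0.
have hN : (t0 < N%:R * (m * e))%R.
  rewrite -ltr_pdivrMr//; apply: archi_boundP.
  by rewrite divr_ge0// ltW.
have := h N; rewrite -(fineK mfin) lee_fin -/m powRN.
rewrite ler_pdivlMr ?powR_gt0// /powR gt_eqF//= => h1.
have := expR_ge1Dx (N%:R * D * ln 2) => h2.
have h3 := le_trans (ler_wpM2l (ltW m0) h2) h1.
by move: h3 hN; rewrite /e; lra.
Qed.

End Endgame.

(** * The embedding *)

Section MainEstimate.
Context (d : measure_display) (R : realType) (T : borelMetricType d R).
Variable mu : {measure set T -> \bar R}.
Hypothesis ball_fin : forall (x : T) (e : R), (0 < e)%R ->
  0 < mu (ball x e) < +oo.

Lemma besov_seminormE (alpha s p : R) (r : \bar R) (beta : R) (q : \bar R)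
    (f : T -> R) :
  besov_seminorm mu alpha s p r beta q f =
  scale_norm s q (LZ_modulus mu alpha p r beta f).
Proof. by case: q. Qed.

(** The iteration described at the top of the file, for a space whose balls have
    measure at least [b 2^(-kD)].  Bounding both norms by one positive number
    [M] avoids dividing by a norm that may vanish. *)
Lemma Linfty_besov_bound (b D p : R) (r : \bar R) (beta alpha s : R)
    (q : \bar R) (g : R) :
  0 < mu [set: T] ->
  (0 < b <= 1)%R -> (0 < D)%R -> (0 < p)%R -> 0 < r -> (0 < alpha)%R ->
  (0 < s)%R -> 0 < q -> (0 < g <= 1)%R ->
  (forall (k : nat) (x : T) (rho : R), (rad R k <= rho)%R ->
    (b * 2 `^ (- (k%:R * D)))%:E <= mu (ball x rho)) ->
  (D / p < s)%R \/
  [/\ s = (D / p)%R, (g%:E < q -> g%:E^-1 - q^-1 < beta%:E) &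
      (q <= g%:E -> (0 <= beta)%R)] ->
  exists2 K : R, (0 < K)%R & forall (f : T -> R) (M : R),
    measurable_fun setT f -> (0 < M)%R ->
    besov_seminorm mu alpha s p r beta q f <= M%:E ->
    sum_norm mu g%:E f < M%:E ->
    'N[mu]_+oo [EFin \o f] <= (K * M)%:E.
Proof.
move=> muT /andP[b0 b1] D0 p0 r0 a0 s0 q0 g01 Bge hyp.
have /andP[g0 g1] := g01.
pose h := (s - D / p)%R.
(* [t0] is chosen so that a ball of radius at least [rad k.+1] has measure at
   least [2 * t k]. *)
pose t0 := (b * 2 `^ (- D) / 2)%R.
have t00 : (0 < t0)%R by rewrite divr_gt0// mulr_gt0// powR_gt0.
have t01 : (t0 <= 1)%R.
  have : (2 `^ (- D) <= 1 :> R)%R.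
    by rewrite -[leRHS](powRr0 2) ler_powR ?ler1n// oppr_le0 ltW.
  have := powR_gt0 (- D) (ltr0Sn R 1).
  by rewrite /t0; nra.
pose t k := (t0 * 2 `^ (- (k%:R * D)))%R.
have tk0 k : (0 < t k)%R by rewrite mulr_gt0// powR_gt0.
have tk1 k : (t k <= 1)%R.
  rewrite /t mulr_ile1 ?powR_ge0 ?(ltW t00)//.
  by rewrite -[leRHS](powRr0 2) ler_powR ?ler1n// oppr_le0 mulr_ge0// ltW.
have tball k x rho : radii k rho -> (2 * t k)%:E <= mu (ball x rho).
  rewrite /radii /= in_itv/= => /andP[kr _].
  apply: le_trans (Bge k.+1 x rho kr).
  have -> : (2 `^ (- (k.+1%:R * D)) = 2 `^ (- (k%:R * D)) * 2 `^ (- D) :> R)%R.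
    rewrite -powRD ?pnatr_eq0 ?implybT// -(@natr1 R k).
    by congr (_ `^ _)%R; ring.
  rewrite lee_fin /t /t0.
  by set X := (2 `^ (- (_ * _)))%R; set Y := (2 `^ (- D))%R; lra.
have [cm cm0 hcm] := LZ_modulus_ge ball_fin beta a0 p0 r0.
have [cw cw0 hcw] :=
  LZ_weight_dyadic_ge beta p0 D0 (introT andP (conj t00 t01)).
have [C1 hC1] : exists C : R, forall u : nat -> R, (forall k, 0 <= u k)%R ->
    lq_bounded q 2 u ->
    forall N, (\sum_(k < N) u k * log_weight h beta k <= C)%R.
  apply: (log_weight_dual 2 g01 q0).
  case: hyp => [Ds|[sE h1 h2]]; first by left; rewrite subr_gt0.
  by right; split => //; rewrite /h sE subrr.
pose C := Num.max C1 0%R.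
have C0 : (0 <= C)%R by rewrite le_max lexx orbT.
pose wc := (2 `^ s / (cm * cw))%R.
have wc0 : (0 < wc)%R by rewrite divr_gt0 ?powR_gt0// mulr_gt0.
pose W k := LZ_weight p beta (t k.+1).
have Wge k : (cw * (2 `^ (- (k.+1%:R * (D / p))) * k.+1%:R `^ beta) <= W k)%R.
  exact: hcw.
have W0 k : (0 < W k)%R.
  by apply: lt_le_trans (Wge k); rewrite !mulr_gt0 ?powR_gt0.
have cW k : (0 < cm * W k)%R by apply: mulr_gt0.
have wle k : (rad R k `^ s / (cm * W k) <= wc * log_weight h beta k)%R.
  rewrite ler_pdivrMr ?cW//.
  have -> : (rad R k `^ s = wc * log_weight h beta k *
     (cm * (cw * (2 `^ (- (k.+1%:R * (D / p))) * k.+1%:R `^ beta))))%R.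
    have xb0 : (0 < k.+1%:R `^ beta :> R)%R by rewrite powR_gt0.
    have -> : (rad R k `^ s =
        2 `^ s * (2 `^ (- (k.+1%:R * h)) * 2 `^ (- (k.+1%:R * (D / p)))))%R.
      rewrite /rad -powRrM -!powRD ?pnatr_eq0 ?implybT// -(@natr1 R k).
      by congr (_ `^ _)%R; rewrite /h; ring.
    rewrite /log_weight (powRN _ beta) /wc.
    set X := (2 `^ (- (_ * h)))%R; set Y := (2 `^ (- (_ * (D / p))))%R.
    by field; rewrite !gt_eqF.
  apply: (ler_wpM2l (mulr_ge0 (ltW wc0) (log_weight_ge0 h beta k))).
  by rewrite (ler_pM2l cm0).
have i0 : (0 < t0^-1)%R by rewrite invr_gt0.
pose l0 := (1 + (t0^-1) `^ g^-1)%R.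
have l00 : (0 < l0)%R by rewrite addr_gt0// powR_gt0.
exists (l0 + (wc * C + 2))%R.
  by rewrite addr_gt0// ltr_wpDl// mulr_ge0// ltW.
move=> f M mf M0; rewrite besov_seminormE => hB hS.
pose E := LZ_modulus mu alpha p r beta f; rewrite -/E in hB.
have E0 rho : 0 <= E rho by exact: LZ_norm_ge0.
have [v [v0 vmax vlq]] := scale_norm_infima s0 q0 M0 E0 hB.
(* The summable extra term makes the increment strictly larger than the
   critical one, for which the superlevel set could still be too large. *)
pose dl k := (v k / (cm * W k) + M * rad R k)%R.
have dl0 k : (0 <= dl k)%R.
  rewrite addr_ge0// ?divr_ge0 ?(ltW (cW k))//.
  by rewrite mulr_ge0 ?(ltW M0)// ltW// rad_gt0.
have step k l : mu [set y | (l < `|f y|)%R] <= (t k)%:E ->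
    mu [set y | (l + dl k < `|f y|)%R] <= (t k.+1)%:E.
  move=> hl; rewrite leNgt; apply/negP => hlt.
  have : (cm * W k * dl k <= v k)%R.
    apply: vmax => rho rk; apply: (hcm f rho (t k) l (dl k) (t k.+1)) => //.
    - move: rk; rewrite /radii /= in_itv/= => /andP[kr _].
      by apply: lt_le_trans kr; exact: rad_gt0.
    - by rewrite tk0 tk1.
    - by move=> x; exact: tball.
  rewrite /dl mulrDr mulrCA mulfV ?gt_eqF// mulr1 gerDl leNgt.
  by rewrite mulr_gt0// mulr_gt0// rad_gt0.
have base : mu [set y | (l0 * M < `|f y|)%R] <= (t 0%N)%:E.
  by rewrite /t mul0r oppr0 powRr0 mulr1; exact: superlevel_sum_norm.
have iter := superlevel_iterate base step.
have sumdl N : (\sum_(k < N) dl k <= (wc * C + 2) * M)%R.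
  rewrite big_split /= mulrDl; apply: lerD; last first.
    by rewrite -mulr_sumr mulrC ler_wpM2r ?(ltW M0)// sum_rad_le2.
  pose u k := (rad R k `^ (- s) * v k / M)%R.
  have u0 k : (0 <= u k)%R by rewrite divr_ge0 ?(ltW M0)// mulr_ge0 ?powR_ge0.
  apply: (@le_trans _ _ (wc * M * \sum_(k < N) u k * log_weight h beta k)%R).
    rewrite mulr_sumr; apply: ler_sum => k _.
    have -> : (v k / (cm * W k) = M * u k * (rad R k `^ s / (cm * W k)))%R.
      rewrite /u powRN; have rs := powR_gt0 s (rad_gt0 R k).
      by field; rewrite !gt_eqF// mulf_neq0// gt_eqF.
    apply: (@le_trans _ _ (M * u k * (wc * log_weight h beta k))%R).
      by rewrite ler_wpM2l// mulr_ge0 ?(ltW M0).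
    by rewrite le_eqVlt; apply/orP; left; apply/eqP; ring.
  rewrite mulrAC ler_wpM2r ?(ltW M0)// ler_wpM2l ?(ltW wc0)//.
  by apply: le_trans (hC1 u u0 vlq N) _; rewrite le_max lexx.
have K0 : (0 <= (l0 + (wc * C + 2)) * M)%R.
  rewrite mulr_ge0 ?(ltW M0)// addr_ge0 ?(ltW l00)//.
  by rewrite addr_ge0// mulr_ge0// ltW.
apply: Lnorm_infty_le => //.
apply: (measure0_of_dyadic D0 t00) => N; apply: le_trans (iter N).
apply: le_measure; rewrite ?inE; [exact: measurable_superlevel..|].
move=> y /=; apply: le_lt_trans; rewrite [leRHS]mulrDl lerD2l; exact: sumdl.
Qed.

End MainEstimate.

Lemma ex_real_mine (R : realType) (p : R) (r : \bar R) : (0 < p)%R -> 0 < r ->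
  exists2 m : R, Order.min p%:E r = m%:E & (0 < m)%R.
Proof.
move=> p0; case: r => [r|_|//] /=; last by exists p => //; rewrite minEle leey.
rewrite lte_fin => r0; exists (Num.min p r); first by rewrite -EFin_min.
by rewrite lt_min p0.
Qed.

Theorem theorem24 (d : measure_display) (R : realType)
    (Omega : borelMetricType d R) (mu : {measure set Omega -> \bar R})
    (mu_doubling : doubling_measure mu)
    (mu_infinite : mu [set: Omega] = +oo)
    (mu_nonatomic : forall x : Omega, mu [set x] = 0)
    (b : R) (b_gt0 : (0 < b)%R)
    (noncollapsing : ereal_inf [set mu (ball x 1%R) | x in [set: Omega]] = b%:E)
    (p : R) (p_gt0 : (0 < p)%R)
    (r : \bar R) (r_gt0 : 0 < r)
    (beta : R)
    (alpha : R) (alpha_adm : admissible_exponent p r beta alpha)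
    (s : R) (s_bounds : (0 < s < 1)%R)
    (q : \bar R) (q_gt0 : 0 < q) :
  let Q := upper_dimension mu in
  let gamma := Order.min 1 (Order.min p%:E r) in
  (Q / p < s)%R \/
  [/\ (s = Q / p)%R,
      (gamma < q -> gamma^-1 - q^-1 < beta%:E) &
      (q <= gamma -> (0 <= beta)%R)] ->
  exists2 c : R, (0 < c)%R &
    forall f : Omega -> R, measurable_fun [set: Omega] f ->
      'N[mu]_+oo [EFin \o f] <=
        c%:E * (besov_seminorm mu alpha s p r beta q f + sum_norm mu gamma f).
Proof.
move=> Q gamma hyp.
have [ball_fin _] := mu_doubling.
have /andP[s0 s1] := s_bounds.
have muT : 0 < mu [set: Omega] by rewrite mu_infinite.
have a0 : (0 < alpha)%R by case: alpha_adm => /andP[].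
have [g gE g01] : exists2 g : R, gamma = g%:E & (0 < g <= 1)%R.
  rewrite /gamma.
  have [m mE m01] := ex_real_mine p_gt0 r_gt0.
  rewrite mE; exists (Num.min 1%R m); first by rewrite -EFin_min.
  by rewrite lt_min ltr01 m01/= ge_min lexx.
rewrite gE in hyp *.
(* In the supercritical case any positive [D] in [[Q, s * p[] will do. *)
have [D [QD D0 Dhyp]] : exists D : R, [/\ (Q <= D)%R, (0 < D)%R &
    (D / p < s)%R \/
    [/\ s = (D / p)%R, (g%:E < q -> g%:E^-1 - q^-1 < beta%:E) &
        (q <= g%:E -> (0 <= beta)%R)]].
  case: hyp => [Qs|hyp].
    exists (Num.max Q (s * p / 2)%R); split; first by rewrite le_max lexx.
      by rewrite lt_max (_ : 0 < s * p / 2)%R ?orbT// divr_gt0// mulr_gt0.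
    left; rewrite ltr_pdivrMr// gt_max -ltr_pdivrMr// Qs /=.
    by have := mulr_gt0 s0 p_gt0; lra.
  exists Q; split => //; last by right.
  by case: hyp => sE _ _; move: s0; rewrite sE pmulr_lgt0// invr_gt0.
pose b1 := Num.min b 1%R.
have b10 : (0 < b1 <= 1)%R by rewrite lt_min b_gt0 ltr01/= ge_min lexx orbT.
have b1x x : b1%:E <= mu (ball x 1%R).
  apply: (@le_trans _ _ b%:E); first by rewrite lee_fin ge_min lexx.
  by rewrite -noncollapsing; apply: ereal_inf_lbound; exists x.
have Bge := mu_ball_rad_ge mu_doubling (proj1 (andP b10)) b1x QD.
have [K K0 hK] := Linfty_besov_bound ball_fin muT b10 D0 p_gt0 r_gt0 a0 s0
  q_gt0 g01 Bge Dhyp.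
exists K => // f mf.
set S := besov_seminorm _ _ _ _ _ _ _ _; set N := sum_norm _ _ _.
have S0 : 0 <= S.
  by rewrite /S besov_seminormE scale_norm_ge0// => rho; exact: LZ_norm_ge0.
have N0 : 0 <= N by exact: sum_norm_ge0.
have [SN|] := ltP (S + N) +oo; last first.
  by rewrite leye_eq => /eqP ->; rewrite gt0_muley ?lte_fin// leey.
have Sfin : S \is a fin_num.
  by rewrite ge0_fin_numE// (le_lt_trans _ SN)// leeDl.
have Nfin : N \is a fin_num.
  by rewrite ge0_fin_numE// (le_lt_trans _ SN)// leeDr.
apply/lee_addgt0Pr => e e0.
have eK : (0 < e / K)%R by rewrite divr_gt0.
have [x xE] : exists x, S = x%:E by exists (fine S); rewrite fineK.
have [y yE] : exists y, N = y%:E by exists (fine N); rewrite fineK.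
have x0 : (0 <= x)%R by rewrite -lee_fin -xE.
have y0 : (0 <= y)%R by rewrite -lee_fin -yE.
have := hK f (x + y + e / K)%R mf; rewrite -/S -/N xE yE.
have -> : (K * (x + y + e / K) = K * (x + y) + e)%R.
  by field; rewrite gt_eqF.
rewrite -!(EFinD, EFinM); apply; rewrite ?lee_fin ?lte_fin; lra.
Qed.
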